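(* Let $0<b_0\le a_0$ and let $a,b$ be independent real random variables, $a$ uniformly distributed on $[-a_0,a_0]$ and $b$ uniformly distributed on $[-b_0,b_0]$. Let $S=2\sqrt{a^2+b^2}$ be the level spacing of the real symmetric random matrix $\begin{pmatrix} a & b\\ b & -a\end{pmatrix}$. Then $S$ has the probability density $$P(S)=\begin{cases}\dfrac{\pi S}{8a_0b_0}, & 0\le S\le 2b_0,\\[2mm] \dfrac{S}{4a_0b_0}\arcsin\dfrac{2b_0}{S}, & 2b_0\le S\le 2a_0,\\[2mm] \dfrac{S}{4a_0b_0}\left(\arcsin\dfrac{2b_0}{S}-\arccos\dfrac{2a_0}{S}\right), & 2a_0\le S\le 2\sqrt{a_0^2+b_0^2},\\[2mm] 0, & S\ge 2\sqrt{a_0^2+b_0^2}.\end{cases}$$ If instead $b_0\ge a_0>0$, the density is obtained by interchanging $a_0$ and $b_0$ in these formulae.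
   Context: The matrix $\begin{pmatrix} a & b\\ b & -a\end{pmatrix}$ has real eigenvalues $\pm\sqrt{a^2+b^2}$; the level spacing is the difference of the two eigenvalues. *)

(* Defs.v *)
From HB Require Import structures.
From mathcomp Require Import all_boot all_order all_algebra.
From mathcomp Require Import all_classical all_reals all_analysis.

Set Implicit Arguments.
Unset Strict Implicit.
Unset Printing Implicit Defensive.

Import Order.TTheory GRing.Theory Num.Theory.
Import numFieldNormedType.Exports.

Local Open Scope classical_set_scope.
Local Open Scope ring_scope.

Definition independent_RV d (T : measurableType d) (R : realType)
    (P : probability T R) (X Y : {RV P >-> R}) : Prop :=
  forall A B : set R, measurable A -> measurable B ->
    P ((X @^-1` A) `&` (Y @^-1` B)) = (P (X @^-1` A) * P (Y @^-1` B))%E.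

(* [X] is a bare function, so its measurability is part of the definition. *)
Definition has_density d (T : measurableType d) (R : realType)
    (P : probability T R) (X : T -> R) (f : R -> R) : Prop :=
  [/\ measurable_fun setT X,
      measurable_fun setT f,
      (forall x, 0 <= f x) &
      forall A : set R, measurable A ->
        pushforward P X A = (\int[lebesgue_measure]_(x in A) (f x)%:E)%E].

Definition symm_traceless_mx (R : realType) (a b : R) : 'M[R]_2 :=
  \matrix_(i, j) if i == j then (if i == 0 then a else - a) else b.

(* Eigenvalues are counted with multiplicity, so that a double eigenvalue
   gives spacing 0. *)
Definition is_level_spacing (R : realType) (M : 'M[R]_2) (s : R) : Prop :=
  exists l1 l2 : R, [/\ l1 <= l2,
    char_poly M = ('X - l1%:P) * ('X - l2%:P) & s = l2 - l1].

(* The density for b0 <= a0.  Adjacent formulae agree at the shared endpoints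
   2 b0, 2 a0 and 2 sqrt (a0 ^ 2 + b0 ^ 2), so the order of the tests there is
   immaterial.  The spacing is nonnegative, hence the value 0 for s < 0. *)
Definition spacing_pdf (R : realType) (a0 b0 s : R) : R :=
  if s < 0 then 0
  else if s <= 2 * b0 then pi * s / (8 * a0 * b0)
  else if s <= 2 * a0 then s / (4 * a0 * b0) * asin (2 * b0 / s)
  else if s <= 2 * Num.sqrt (a0 ^+ 2 + b0 ^+ 2) then
    s / (4 * a0 * b0) * (asin (2 * b0 / s) - acos (2 * a0 / s))
  else 0.

(* Main.v *)
Require Import Defs.
From HB Require Import structures.
From mathcomp Require Import all_boot all_order all_algebra.
From mathcomp Require Import all_classical all_reals all_analysis.
From mathcomp Require Import measurable_realfun ring lra.

(** In the positive quadrant put [y = x * u] with [x] fixed, then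
    [x = r / sqrt (1 + u ^ 2)] with [u] fixed.  Both changes of variable are
    linear, so with two uses of Tonelli's theorem they replace polar
    coordinates: the angular part of the density at radius [r = S / 2] is the
    integral of [1 / (1 + u ^ 2)] over the slopes [u] of the points of the
    rectangle at distance [r] from the origin, a difference of arctangents. *)

Import Order.TTheory GRing.Theory Num.Theory.
Import numFieldNormedType.Exports.

Local Open Scope classical_set_scope.
Local Open Scope ring_scope.

(** * Integrals of even functions over the real line *)

Section even.
Context {R : realType}.
Notation mu := (@lebesgue_measure R).
Local Open Scope ereal_scope.

Lemma ge0_integral_even (f : R -> \bar R) :
  measurable_fun [set: R] f -> (forall x, 0 <= f x) ->
  (forall x, f (- x)%R = f x) ->
  \int[mu]_x f x = 2%:E * \int[mu]_(x in `]0%R, +oo[) f x.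
Proof.
move=> mf f0 fE.
have mfS (A : set R) : measurable_fun A f by exact: measurable_funTS.
rewrite -(setUv `]0%R, +oo[) ge0_integral_setU//=; last 3 first.
- exact: measurableC.
- exact: mfS.
- exact/disj_setPCl.
rewrite mule_natl mule2n; congr +%E.
(* Adding the null point 0 makes the half-line the mirror image of the complement []-oo, 0]]. *)
rewrite [in RHS]integral_itv_obnd_cbnd// ge0_integration_by_substitution0//.
by rewrite setCitvr/=; under [in RHS]eq_integral do rewrite fE.
Qed.

End even.

(** * Linear change of variable on the half-line *)

Section scaling.
Context {R : realType}.
Notation mu := (@lebesgue_measure R).
Local Open Scope ereal_scope.

Lemma preimage_mull_itvoc (c a b : R) : (0 < c)%R ->
  ( *%R c) @^-1` `]a, b] = `](c^-1 * a)%R, (c^-1 * b)%R]%classic.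
Proof.
move=> c0; apply/seteqP; split => x /=; rewrite !in_itv/= => /andP[ax xb].
  by rewrite ltr_pdivrMl// ler_pdivlMl// ax.
by rewrite -ltr_pdivrMl// -ler_pdivlMl// ax.
Qed.

(** The image of Lebesgue measure under multiplication by [c], rescaled by [c], agrees with Lebesgue
    measure on half-open intervals, hence everywhere by uniqueness. The half-line is its own
    preimage. *)
Lemma ge0_integral_scale {c : R} (f : R -> \bar R) : (0 < c)%R ->
  measurable_fun [set: R] f -> (forall x, 0 <= f x) ->
  \int[mu]_(x in `]0%R, +oo[) f x =
  c%:E * \int[mu]_(x in `]0%R, +oo[) f (c * x)%R.
Proof.
move=> c0 mf f0.
pose phi : measurableTypeR R -> measurableTypeR R := *%R c.
have mphi : measurable_fun [set: measurableTypeR R] phi by exact: mulrl_measurable.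
pose m := mscale (NngNum (ltW c0))
  (measure_function_pushforward__canonical__measure_function_Measure mu mphi).
have mE_itv a b : mu `]a, b]%classic = m `]a, b]%classic.
  transitivity (c%:E * mu (( *%R c) @^-1` `]a, b])); last by [].
  rewrite preimage_mull_itvoc// !lebesgue_measure_itv/= !lte_fin.
  rewrite ltr_pM2l ?invr_gt0//; case: ifP => _; last by rewrite mule0.
  by rewrite -!EFinB -EFinM -mulrBr mulrA divff ?gt_eqF// mul1r.
have mE A : measurable A -> mu A = m A.
  by apply: (@lebesgue_measure_unique _ m) => _ [[a b] _ <-]; exact: mE_itv.
rewrite (eq_measure_integral m); last by move=> A mA _; exact: mE.
rewrite ge0_integral_mscale//=; last exact: measurable_funTS.
congr (_ * _); rewrite ge0_integral_pushforward//=; last exact: measurable_funTS.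
suff -> : phi @^-1` `]0%R, +oo[%classic = `]0%R, +oo[%classic by [].
by apply/seteqP; split => x /=; rewrite !in_itv/= !andbT /phi pmulr_rgt0.
Qed.

End scaling.

(** * Tonelli's theorem over a product of measurable subsets *)

Section tonelli_restricted.
Context {d1 d2} {T1 : measurableType d1} {T2 : measurableType d2} {R : realType}.
Context {m1 : {sigma_finite_measure set T1 -> \bar R}}
  {m2 : {sigma_finite_measure set T2 -> \bar R}}.
Context {D1 : set T1} {D2 : set T2} (f : T1 * T2 -> \bar R).
Hypotheses (mD1 : measurable D1) (mD2 : measurable D2).
Hypothesis (mf : measurable_fun [set: T1 * T2] f).
Hypothesis (f0 : forall x y, D1 x -> D2 y -> (0 <= f (x, y))%E).
Local Open Scope ereal_scope.

(** Extension by zero reduces the claims to Tonelli on the whole product. Nonnegativity is then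
    needed only on [D1] and [D2], which suits the polar integrands: their radial factor is negative
    off the half-line. *)
Let g := f \_ (D1 `*` D2).

Let mg : measurable_fun [set: T1 * T2] g.
Proof.
apply: (measurable_restrictT _ _).1; first exact: measurableX.
exact: measurable_funTS.
Qed.

Let g0 z : 0 <= g z.
Proof.
case: z => x y; rewrite /g patchE; case: ifPn => //.
by rewrite inE => -[]; exact: f0.
Qed.

Let gE1 x : \int[m2]_y g (x, y) =
  ((fun x => \int[m2]_(y in D2) f (x, y)) \_ D1) x.
Proof.
rewrite patchE; case: ifPn => xD1.
  rewrite [RHS]integral_mkcond; apply: eq_integral => y _.
  by rewrite /g !patchE in_setX xD1.
by apply: integral0_eq => y _; rewrite /g patchE in_setX (negbTE xD1).
Qed.

Let gE2 y : \int[m1]_x g (x, y) =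
  ((fun y => \int[m1]_(x in D1) f (x, y)) \_ D2) y.
Proof.
rewrite patchE; case: ifPn => yD2.
  rewrite [RHS]integral_mkcond; apply: eq_integral => x _.
  by rewrite /g !patchE in_setX yD2 andbT.
by apply: integral0_eq => x _; rewrite /g patchE in_setX (negbTE yD2) andbF.
Qed.

Lemma measurable_fun_integral_restrict :
  measurable_fun D1 (fun x => \int[m2]_(y in D2) f (x, y)).
Proof.
apply: (measurable_restrictT _ mD1).2.
rewrite (_ : _ \_ _ = fun x => \int[m2]_y g (x, y)).
  exact: measurable_fun_fubini_tonelli_F.
by apply/funext => x; rewrite gE1.
Qed.

Lemma fubini_tonelli_restrict :
  \int[m1]_(x in D1) \int[m2]_(y in D2) f (x, y) =
  \int[m2]_(y in D2) \int[m1]_(x in D1) f (x, y).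
Proof.
rewrite integral_mkcond [RHS]integral_mkcond.
under eq_integral do rewrite -gE1.
under [RHS]eq_integral do rewrite -gE2.
exact: fubini_tonelli.
Qed.

End tonelli_restricted.

(** * Polar coordinates on the open quadrant, with the slope in place of the angle *)

Section polar.
Context {R : realType}.
Notation mu := (@lebesgue_measure R).
Local Open Scope ereal_scope.

Lemma measurable_sqrt_oneDsqr :
  measurable_fun [set: R] (fun u : R => Num.sqrt (oneDsqr u)).
Proof.
apply: continuous_measurable_fun => u.
by apply: continuous_comp; [exact: continuous_oneDsqr|exact: sqrt_continuous].
Qed.

Lemma measurable_sqrt_oneDsqrV :
  measurable_fun [set: R] (fun u : R => (Num.sqrt (oneDsqr u))^-1%R).
Proof.
apply: continuous_measurable_fun => u; apply: cvgV.
  by rewrite gt_eqF// sqrtr_gt0 (lt_le_trans ltr01)// oneDsqr_ge1.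
by apply: continuous_comp; [exact: continuous_oneDsqr|exact: sqrt_continuous].
Qed.

(** The first substitution contributes the factor [x], which becomes [r / sqrt (1 + u ^ 2)]; the
    second contributes another [1 / sqrt (1 + u ^ 2)]. With [u = tan theta] the weight
    [r / (1 + u ^ 2)] is the usual [r dr dtheta]. *)
Lemma ge0_integral_polar {G : R * R -> \bar R} :
  measurable_fun [set: R * R] G -> (forall z, 0 <= G z) ->
  \int[mu]_(x in `]0%R, +oo[) \int[mu]_(y in `]0%R, +oo[) G (x, y) =
  \int[mu]_(r in `]0%R, +oo[) \int[mu]_(u in `]0%R, +oo[)
    ((r / oneDsqr u)%:E *
     G (r / Num.sqrt (oneDsqr u), r / Num.sqrt (oneDsqr u) * u)%R).
Proof.
move=> mG G0.
pose D : set R := `]0%R, +oo[%classic.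
have mD : measurable D by exact: measurable_itv.
have posD (x : R) : x \in D -> (0 < x)%R by rewrite /D inE/= in_itv/= andbT.
have c_gt0 (u : R) : (0 < Num.sqrt (oneDsqr u))%R.
  by rewrite sqrtr_gt0 (lt_le_trans ltr01)// oneDsqr_ge1.
have mcV := measurable_sqrt_oneDsqrV.
pose F (z : R * R) := z.1%:E * G (z.1, z.1 * z.2)%R.
have mF : measurable_fun [set: R * R] F.
  apply: emeasurable_funM; first exact/measurable_EFinP.
  apply: (measurableT_comp mG); apply: measurable_fun_pair => //.
  exact: measurable_funM.
pose H (z : R * R) := ((z.1 / oneDsqr z.2)%:E *
  G (z.1 / Num.sqrt (oneDsqr z.2), z.1 / Num.sqrt (oneDsqr z.2) * z.2)%R).
have mH : measurable_fun [set: R * R] H.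
  have m1 : measurable_fun [set: R * R]
      (fun z : R * R => z.1 / Num.sqrt (oneDsqr z.2))%R.
    by apply: measurable_funM => //; exact: (measurableT_comp mcV).
  apply: emeasurable_funM.
    apply/measurable_EFinP; apply: measurable_funM => //.
    have m2 : measurable_fun [set: R] (fun u : R => (oneDsqr u)^-1%R).
      by apply: continuous_measurable_fun; exact: continuous_oneDsqrV.
    exact: (measurableT_comp m2).
  apply: (measurableT_comp mG); apply: measurable_fun_pair => //.
  exact: measurable_funM.
have F0 x u : D x -> D u -> 0 <= F (x, u).
  by move=> /mem_set/posD x0 _; rewrite mule_ge0// lee_fin ltW.
have H0 x u : D x -> D u -> 0 <= H (x, u).
  move=> /mem_set/posD x0 _; rewrite mule_ge0// lee_fin.
  by rewrite mulr_ge0 ?invr_ge0 ?ltW// (lt_le_trans ltr01)// oneDsqr_ge1.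
(* Substitution [y = x * u] at fixed [x]; the exchange of integrals that follows makes [u] the fixed
   variable. *)
transitivity (\int[mu]_(x in D) \int[mu]_(u in D) F (x, u)).
  apply: eq_integral => x /posD x0.
  have mGx : measurable_fun [set: R] (fun y => G (x, y)).
    exact: measurable_fun_pair2.
  rewrite (ge0_integral_scale (fun y => G (x, y)) x0)// -ge0_integralZl//.
  - apply: measurable_funTS.
    exact: (measurableT_comp mGx (mulrl_measurable x)).
  - by rewrite lee_fin ltW.
transitivity (\int[mu]_(u in D) \int[mu]_(x in D) F (x, u)).
  exact: (@fubini_tonelli_restrict _ _ (measurableTypeR R) (measurableTypeR R)).
transitivity (\int[mu]_(u in D) \int[mu]_(r in D) H (r, u)); last first.
  apply/esym.
  exact: (@fubini_tonelli_restrict _ _ (measurableTypeR R) (measurableTypeR R)).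
apply: eq_integral => u /posD u0.
have cV_gt0 : (0 < (Num.sqrt (oneDsqr u))^-1)%R by rewrite invr_gt0.
(* The absolute value makes the integrand nonnegative on the whole line, as [ge0_integral_scale]
   requires; on the half-line nothing changes. *)
pose F' (r : R) := (`|r|)%:E * G (r, r * u)%R.
have mF' : measurable_fun [set: R] F'.
  apply: emeasurable_funM; first by apply/measurable_EFinP; exact: normr_measurable.
  apply: (measurableT_comp mG); apply: measurable_fun_pair => //.
  exact: measurable_funM.
have F'0 r : 0 <= F' r by rewrite mule_ge0.
transitivity (\int[mu]_(r in D) F' r).
  by apply: eq_integral => r /posD r0; rewrite /F' gtr0_norm.
set k := ((Num.sqrt (oneDsqr u))^-1)%R in cV_gt0 *.
have kk : (k * k = (oneDsqr u)^-1)%R.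
  by rewrite -invfM -expr2 sqr_sqrtr// (le_trans ler01)// oneDsqr_ge1.
rewrite (ge0_integral_scale _ cV_gt0)// -ge0_integralZl//=.
- apply: eq_integral => r /posD r0.
  rewrite /F' /H/= -/k gtr0_norm ?mulr_gt0// (mulrC k r).
  by rewrite muleA -EFinM mulrCA kk.
- apply: measurable_funTS.
  exact: (measurableT_comp mF' (mulrl_measurable _)).
- by rewrite lee_fin ltW.
Qed.

End polar.

(** * The angular integral over the part of a circle inside the rectangle *)

Section arc.
Context {R : realType}.
Notation mu := (@lebesgue_measure R).
Implicit Types a b c d r u x : R.

Lemma sin_atan x : sin (atan x) = x / Num.sqrt (1 + x ^+ 2).
Proof.
rewrite -{2}(atanK x) -cos_atan /tan mulfVK// gt_eqF//.
by rewrite cos_gt0_pihalf// atan_gtNpi2 atan_ltpi2.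
Qed.

Lemma asin_atan x : asin (x / Num.sqrt (1 + x ^+ 2)) = atan x.
Proof.
by rewrite -sin_atan sinK// in_itv/= !ltW ?atan_gtNpi2 ?atan_ltpi2.
Qed.

Lemma acos_atan x : 0 <= x -> acos (Num.sqrt (1 + x ^+ 2))^-1 = atan x.
Proof.
move=> x0; rewrite -cos_atan cosK// in_itv/= -{1}atan0 le_atan//=.
by rewrite (le_trans (ltW (atan_ltpi2 x)))// ler_pdivrMr// ler_peMr ?pi_ge0 ?ler1n.
Qed.

(** Brings the arcsine of the density to the form [atan] of an extreme slope, as produced by the
    primitive of [1 / (1 + u ^ 2)]. At [r = b] that slope would be infinite, hence the strict
    inequality. *)
Lemma asin_div b r : 0 < b -> b < r ->
  asin (b / r) = atan (b / Num.sqrt (r ^+ 2 - b ^+ 2)).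
Proof.
move=> b0 br; have r0 := lt_trans b0 br.
have q0 : 0 < r ^+ 2 - b ^+ 2 by rewrite subr_gt0 ltr_pXn2r// nnegrE ltW.
rewrite -asin_atan expr_div_n sqr_sqrtr ?ltW//.
have -> : 1 + b ^+ 2 / (r ^+ 2 - b ^+ 2) = r ^+ 2 / (r ^+ 2 - b ^+ 2).
  by field; rewrite gt_eqF.
rewrite sqrtrM ?sqr_ge0// sqrtr_sqr gtr0_norm// sqrtrV ?ltW//.
by congr asin; field; rewrite !gt_eqF//= sqrtr_gt0.
Qed.

Lemma acos_div a r : 0 < a -> a <= r ->
  acos (a / r) = atan (Num.sqrt (r ^+ 2 - a ^+ 2) / a).
Proof.
move=> a0 ar; have r0 := lt_le_trans a0 ar.
have q0 : 0 <= r ^+ 2 - a ^+ 2 by rewrite subr_ge0 ler_pXn2r// nnegrE ltW.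
rewrite -acos_atan; last by rewrite divr_ge0 ?sqrtr_ge0// ltW.
rewrite expr_div_n sqr_sqrtr//.
have -> : 1 + (r ^+ 2 - a ^+ 2) / a ^+ 2 = (r / a) ^+ 2 by field; rewrite gt_eqF.
by rewrite sqrtr_sqr gtr0_norm ?divr_gt0// invf_div.
Qed.

Lemma integral_oneDsqrV c d : c <= d ->
  (\int[mu]_(u in `[c, d]) (oneDsqr u)^-1%:E = (atan d - atan c)%:E)%E.
Proof.
rewrite le_eqVlt => /predU1P[<-|cd].
  by rewrite set_itv1 integral_set1 subrr.
rewrite (@continuous_FTC2 _ _ atan)//.
- by apply: continuous_in_subspaceT => x ?; exact: continuous_oneDsqrV.
- split.
  + by move=> x _; exact: derivable_atan.
  + by apply: cvg_at_right_filter; exact: continuous_atan.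
  + by apply: cvg_at_left_filter; exact: continuous_atan.
- by move=> x _; rewrite derive1_atan.
Qed.

Let measurable_oneDsqrV (D : set R) :
  measurable_fun D (fun u : R => (oneDsqr u)^-1%:E).
Proof.
apply/measurable_EFinP; apply: measurable_funTS.
by apply: continuous_measurable_fun; exact: continuous_oneDsqrV.
Qed.

Lemma le_mul_sqrt_oneDsqr a r u : 0 <= a -> 0 <= r ->
  (r <= a * Num.sqrt (oneDsqr u)) = (r ^+ 2 - a ^+ 2 <= a ^+ 2 * u ^+ 2).
Proof.
move=> a0 r0; rewrite -(@ler_pXn2r _ 2)// ?nnegrE ?mulr_ge0 ?sqrtr_ge0//.
rewrite exprMn sqr_sqrtr ?(le_trans ler01) ?oneDsqr_ge1//.
by rewrite /oneDsqr mulrDr mulr1 lerBlDl.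
Qed.

(* The range of [u = y / x] on the arc of radius [r] in the rectangle
   [0 < x <= a], [0 < y <= b]. *)
Definition arc_slopes a b r : set R :=
  [set u | r <= a * Num.sqrt (oneDsqr u) /\ r * u <= b * Num.sqrt (oneDsqr u)].

(** The angle that this arc subtends at the origin when [b <= a]. At [r = s / 2] its four cases are
    those of the density. *)
Definition arc_angle a b r :=
  if r <= b then pi / 2
  else if r <= a then asin (b / r)
  else if r <= Num.sqrt (a ^+ 2 + b ^+ 2) then asin (b / r) - acos (a / r)
  else 0.

(** The side [y = b] meets the circle at [(sqrt (r ^ 2 - b ^ 2), b)], whose slope is the largest one
    allowed. *)
Lemma mul_le_sqrt_oneDsqr b r u : 0 < b -> b < r -> 0 < u ->
  (r * u <= b * Num.sqrt (oneDsqr u)) = (u <= b / Num.sqrt (r ^+ 2 - b ^+ 2)).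
Proof.
move=> b0 br u0; have r0 := lt_trans b0 br.
have [[b_ge0 u_ge0] r_ge0] := (ltW b0, ltW u0, ltW r0).
have q0 : 0 < r ^+ 2 - b ^+ 2 by rewrite subr_gt0 ltr_pXn2r.
rewrite le_mul_sqrt_oneDsqr ?mulr_ge0// ler_pdivlMr ?sqrtr_gt0//.
rewrite -[RHS](@ler_pXn2r _ 2) ?nnegrE ?mulr_ge0 ?sqrtr_ge0//.
rewrite [in RHS]exprMn sqr_sqrtr ?(ltW q0)//.
by apply/idP/idP => h; lra.
Qed.

(** The side [x = a] meets the circle at [(a, sqrt (r ^ 2 - a ^ 2))], whose slope is the smallest
    one allowed. *)
Lemma le_sqrt_oneDsqr_div a r u : 0 < a -> a <= r -> 0 < u ->
  (r <= a * Num.sqrt (oneDsqr u)) = (Num.sqrt (r ^+ 2 - a ^+ 2) / a <= u).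
Proof.
move=> a0 ar u0; have r0 := lt_le_trans a0 ar.
have [[a_ge0 u_ge0] r_ge0] := (ltW a0, ltW u0, ltW r0).
have q0 : 0 <= r ^+ 2 - a ^+ 2 by rewrite subr_ge0 ler_pXn2r.
rewrite le_mul_sqrt_oneDsqr// ler_pdivrMr//.
rewrite -[RHS](@ler_pXn2r _ 2) ?nnegrE ?mulr_ge0 ?sqrtr_ge0//.
by rewrite sqr_sqrtr// exprMn mulrC.
Qed.

(** Slopes remain exactly as long as the circle does not pass beyond the corner [(a, b)].
    Algebraically, [(r ^ 2 - a ^ 2) * (r ^ 2 - b ^ 2) <= a ^ 2 * b ^ 2] reduces to
    [r ^ 4 <= r ^ 2 * (a ^ 2 + b ^ 2)], which is why the right side is multiplied by [r ^ 2]. *)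
Lemma arc_slopes_endpoints a b r : 0 < b -> b <= a -> a < r ->
  (Num.sqrt (r ^+ 2 - a ^+ 2) / a <= b / Num.sqrt (r ^+ 2 - b ^+ 2)) =
  (r <= Num.sqrt (a ^+ 2 + b ^+ 2)).
Proof.
move=> b0 ba ar; have a0 := lt_le_trans b0 ba; have r0 := lt_trans a0 ar.
have [[a_ge0 b_ge0] r_ge0] := (ltW a0, ltW b0, ltW r0).
have q0 : 0 < r ^+ 2 - a ^+ 2 by rewrite subr_gt0 ltr_pXn2r.
have p0 : 0 < r ^+ 2 - b ^+ 2 by rewrite subr_gt0 ltr_pXn2r// (le_lt_trans ba).
rewrite ler_pdivrMr// mulrAC ler_pdivlMr ?sqrtr_gt0//.
rewrite -[LHS](@ler_pXn2r _ 2) ?nnegrE ?mulr_ge0 ?sqrtr_ge0//.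
rewrite -[RHS](@ler_pXn2r _ 2) ?nnegrE ?sqrtr_ge0//.
rewrite !exprMn !sqr_sqrtr ?(ltW q0) ?(ltW p0) ?addr_ge0 ?sqr_ge0//.
rewrite -[RHS](@ler_pM2l _ (r ^+ 2)) ?exprn_gt0//.
by apply/idP/idP => h; lra.
Qed.

Lemma integral_arc_slopes a b r : 0 < b -> b <= a -> 0 < r ->
  (\int[mu]_(u in `]0%R, +oo[ `&` arc_slopes a b r) (oneDsqr u)^-1%:E =
   (arc_angle a b r)%:E)%E.
Proof.
move=> b0 ba r0; have a0 := lt_le_trans b0 ba.
have c_ge u : u <= Num.sqrt (oneDsqr u).
  rewrite (le_trans (ler_norm u))// -sqrtr_sqr ler_sqrt ?oneDsqr_ge1.
    by rewrite /oneDsqr lerDr.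
  by rewrite (le_trans ler01)// oneDsqr_ge1.
have c_ge1 u : 1 <= Num.sqrt (oneDsqr u).
  by rewrite -{1}(@sqrtr1 R) ler_sqrt ?oneDsqr_ge1// (le_trans ler01)// oneDsqr_ge1.
have ra_slope u : r <= a -> r <= a * Num.sqrt (oneDsqr u).
  by move=> ra; rewrite (le_trans ra)// ler_peMr// ltW.
rewrite /arc_angle; case: ifPn => [rb|].
  (* Neither side cuts the arc: every positive slope is allowed, and the integral is a full quarter
     turn. *)
  rewrite (_ : _ `&` _ = `]0%R, +oo[%classic); last first.
    apply: setIidl => u /=; rewrite in_itv/= andbT => u0; split.
      exact/ra_slope/(le_trans rb).
    by apply: ler_pM => //; exact: ltW.
  rewrite integral_itv_obnd_cbnd; last exact: measurable_oneDsqrV.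
  exact: integral0y_oneDsqr.
rewrite -ltNge => br.
have d_gt0 : 0 < b / Num.sqrt (r ^+ 2 - b ^+ 2).
  by rewrite divr_gt0// sqrtr_gt0 subr_gt0 ltr_pXn2r// nnegrE ltW.
case: ifPn => [ra|].
  (* Only the side [y = b] cuts the arc, so the slopes start at 0. *)
  rewrite (_ : _ `&` _ =
      `]0%R, (b / Num.sqrt (r ^+ 2 - b ^+ 2))%R]%classic); last first.
    apply/seteqP; split => u /=; rewrite !in_itv/= andbT.
      by move=> [u0 [_ ?]]; rewrite u0 -mul_le_sqrt_oneDsqr.
    move=> /andP[u0 ud]; split => //; split; first exact: ra_slope.
    by rewrite mul_le_sqrt_oneDsqr.
  rewrite integral_itv_obnd_cbnd; last exact: measurable_oneDsqrV.
  by rewrite integral_oneDsqrV ?ltW// atan0 subr0 asin_div.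
rewrite -ltNge => ar.
have c_gt0 : 0 < Num.sqrt (r ^+ 2 - a ^+ 2) / a.
  by rewrite divr_gt0// sqrtr_gt0 subr_gt0 ltr_pXn2r// nnegrE ltW.
(* Both sides cut the arc. The lower endpoint is positive, so the closed interval lies inside the
   half-line. *)
rewrite (_ : _ `&` _ = [set` `[(Num.sqrt (r ^+ 2 - a ^+ 2) / a)%R,
    (b / Num.sqrt (r ^+ 2 - b ^+ 2))%R]]); last first.
  apply/seteqP; split => u /=; rewrite !in_itv/= andbT.
    move=> [u0 []].
    by rewrite le_sqrt_oneDsqr_div ?(ltW ar)// mul_le_sqrt_oneDsqr// => -> ->.
  move=> /andP[cu ud]; have u0 := lt_le_trans c_gt0 cu.
  by rewrite /arc_slopes/= le_sqrt_oneDsqr_div ?(ltW ar)// mul_le_sqrt_oneDsqr.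
rewrite -arc_slopes_endpoints//; case: ifPn => [cd|].
  by rewrite integral_oneDsqrV// asin_div// acos_div// ltW.
by rewrite -ltNge => cd; rewrite set_itv_ge ?integral_set0// bnd_simp -ltNge.
Qed.

(** Read off from the integral, so that [asin] and [acos] need not be compared. *)
Lemma arc_angle_ge0 a b r : 0 < b -> b <= a -> 0 < r -> 0 <= arc_angle a b r.
Proof.
move=> b0 ba r0; rewrite -lee_fin -integral_arc_slopes//.
apply: integral_ge0 => u _; rewrite lee_fin invr_ge0.
by rewrite (le_trans ler01)// oneDsqr_ge1.
Qed.

End arc.

(** * Area of the points of the rectangle with prescribed radii *)

Section rectangle.
Context {R : realType}.
Notation mu := (@lebesgue_measure R).
Implicit Types (a b r s : R) (A : set R).

Let D : set R := `]0, +oo[%classic.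

Let posD (x : R) : x \in D -> 0 < x.
Proof. by rewrite /D inE/= in_itv/= andbT. Qed.

Let mD : measurable D.
Proof. exact: measurable_itv. Qed.

Lemma measurable_spacing : measurable_fun [set: R * R]
  (fun z : R * R => 2 * Num.sqrt (z.1 ^+ 2 + z.2 ^+ 2)).
Proof.
apply: measurable_funM => //.
apply: (@measurableT_comp _ _ _ _ _ _ (@Num.sqrt R)).
  by apply: continuous_measurable_fun; exact: sqrt_continuous.
by apply: measurable_funD; apply: measurable_funX.
Qed.

Definition rect_radius a b A : set (R * R) :=
  [set z | [/\ `|z.1| <= a, `|z.2| <= b & A (2 * Num.sqrt (z.1 ^+ 2 + z.2 ^+ 2))]].

Lemma measurable_rect_radius a b A :
  measurable A -> measurable (rect_radius a b A).
Proof.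
move=> mA.
rewrite (_ : rect_radius a b A = [set z : R * R | `|z.1| <= a] `&`
    [set z | `|z.2| <= b] `&` [set z | A (2 * Num.sqrt (z.1 ^+ 2 + z.2 ^+ 2))]); last first.
  by apply/seteqP; split => z /=; [move=> []|move=> [[]]].
apply: measurableI; last first.
  by rewrite -[X in measurable X]setTI; exact: measurable_spacing.
apply: measurableI; rewrite -[X in measurable X]setTI;
  by apply: measurable_fun_le => //; exact: measurableT_comp.
Qed.

Lemma measurable_arc_slopes a b r : measurable (arc_slopes a b r).
Proof.
rewrite (_ : arc_slopes a b r = [set u | r <= a * Num.sqrt (oneDsqr u)] `&`
  [set u | r * u <= b * Num.sqrt (oneDsqr u)])//.
have mc c : measurable_fun [set: R] (fun u : R => c * Num.sqrt (oneDsqr u)).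
  by apply: measurable_funM => //; exact: measurable_sqrt_oneDsqr.
by apply: measurableI; rewrite -[X in measurable X]setTI;
  apply: measurable_fun_le => //; exact: measurable_funM.
Qed.

(** The point has radius exactly [r] and positive coordinates, so membership separates into a
    condition on [r] alone and one on the slope. *)
Lemma rect_radius_polar a b A r u : 0 < r -> 0 < u ->
  (r / Num.sqrt (oneDsqr u), r / Num.sqrt (oneDsqr u) * u) \in rect_radius a b A =
  ((2 * r \in A) && (u \in arc_slopes a b r)).
Proof.
move=> r0 u0.
have q0 : 0 < oneDsqr u by rewrite (lt_le_trans ltr01)// oneDsqr_ge1.
have c0 : 0 < Num.sqrt (oneDsqr u) by rewrite sqrtr_gt0.
have k0 : 0 < r / Num.sqrt (oneDsqr u) by rewrite divr_gt0.
have rE : Num.sqrt ((r / Num.sqrt (oneDsqr u)) ^+ 2 +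
                    (r / Num.sqrt (oneDsqr u) * u) ^+ 2) = r.
  rewrite [X in _ + X]exprMn -{1}(mulr1 (_ ^+ 2)) -mulrDr expr_div_n sqr_sqrtr ?ltW//.
  by rewrite -/(oneDsqr u) mulfVK ?gt_eqF// sqrtr_sqr gtr0_norm.
have -> : (2 * r \in A) && (u \in arc_slopes a b r) =
  [&& 2 * r \in A, r <= a * Num.sqrt (oneDsqr u)
      & r * u <= b * Num.sqrt (oneDsqr u)].
  by congr andb; apply/idP/andP; rewrite inE.
rewrite -(ler_pdivrMr a r c0) -(ler_pdivrMr b (r * u) c0) (mulrAC r u).
apply/idP/and3P; rewrite !inE /rect_radius/= rE !gtr0_norm ?mulr_gt0//; by case.
Qed.

Lemma integral_rect_radius a b A : 0 < b -> b <= a -> measurable A ->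
  (\int[mu]_(x in `]0%R, +oo[) \int[mu]_(y in `]0%R, +oo[)
     (\1_(rect_radius a b A) (x, y))%:E =
   \int[mu]_(r in `]0%R, +oo[) (\1_A (2 * r) * (r * arc_angle a b r))%:E)%E.
Proof.
move=> b0 ba mA.
have m1 : measurable_fun [set: R * R] (fun z => (\1_(rect_radius a b A) z)%:E : \bar R).
  by apply/measurable_EFinP; apply: measurable_indic; exact: measurable_rect_radius.
rewrite (ge0_integral_polar m1); last by move=> z; rewrite lee_fin.
apply: eq_integral => r /posD r0.
(* The factor free of [u] is split off; what remains is the angular weight cut down to
   [arc_slopes]. *)
transitivity (\int[mu]_(u in D)
    ((\1_A (2 * r) * r)%:E * ((fun u => (oneDsqr u)^-1%:E) \_ (arc_slopes a b r)) u))%E.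
  apply: eq_integral => u /posD u0.
  rewrite /= indicE rect_radius_polar// patchE indicE.
  case: (_ \in A) => /=; last by rewrite mulr0n !mul0r mule0 mul0e.
  case: (_ \in arc_slopes _ _ _); last by rewrite !mule0.
  by rewrite -!EFinM mulr1 mul1r.
rewrite ge0_integralZl//.
- rewrite -integral_mkcondr integral_arc_slopes// -EFinM.
  by rewrite mulrA.
- apply: (measurable_funS measurableT) => //.
  apply: (measurable_restrictT _ _).1; first exact: measurable_arc_slopes.
  apply/measurable_EFinP; apply: measurable_funTS.
  by apply: continuous_measurable_fun; exact: continuous_oneDsqrV.
- by move=> u _; rewrite patchE; case: ifP.
- by rewrite lee_fin mulr_ge0// ltW.
Qed.

(** As an integral depending on the parameter [r], the angle is measurable by Tonelli; the closed
    formula with [asin] and [acos] is not examined. *)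
Lemma measurable_arc_angle a b : 0 < b -> b <= a ->
  measurable_fun (`]0, +oo[%classic : set R) (arc_angle a b).
Proof.
move=> b0 ba.
pose W := [set z : R * R | arc_slopes a b z.1 z.2].
have mc c : measurable_fun [set: R * R]
    (fun z : R * R => c * Num.sqrt (oneDsqr z.2)).
  apply: measurable_funM => //.
  exact: (measurableT_comp measurable_sqrt_oneDsqr).
have mW : measurable W.
  rewrite (_ : W = [set z | z.1 <= a * Num.sqrt (oneDsqr z.2)] `&`
    [set z | z.1 * z.2 <= b * Num.sqrt (oneDsqr z.2)])//.
  by apply: measurableI; rewrite -[X in measurable X]setTI;
    apply: measurable_fun_le => //; exact: measurable_funM.
pose F (z : R * R) := (\1_W z * (oneDsqr z.2)^-1)%:E.
have mV : measurable_fun [set: R] (fun u : R => (oneDsqr u)^-1).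
  by apply: continuous_measurable_fun; exact: continuous_oneDsqrV.
have mF : measurable_fun [set: R * R] F.
  apply/measurable_EFinP; apply: measurable_funM.
    exact: measurable_indic.
  exact: (measurableT_comp mV).
apply/measurable_EFinP.
apply: (@eq_measurable_fun _ _ _ _ _ (fun r => \int[mu]_(u in D) F (r, u))%E).
  move=> r /posD r0 /=; rewrite -integral_arc_slopes// integral_mkcondr.
  apply: eq_integral => u _; rewrite patchE /F indicE/=.
  rewrite (_ : (r, u) \in W = (u \in arc_slopes a b r)); last first.
    by apply/idP/idP; rewrite !inE.
  by case: ifP => _; rewrite ?mul1r ?mul0r.
apply: (@measurable_fun_integral_restrict _ _ (measurableTypeR R)
  (measurableTypeR R) R mu D D F) => // r u _ _.
by rewrite lee_fin mulr_ge0// invr_ge0 (le_trans ler01)// oneDsqr_ge1.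
Qed.

End rectangle.

(** * From the uniform law on the rectangle to the density of the spacing *)

Section law.
Context {R : realType}.
Notation mu := (@lebesgue_measure R).

Lemma spacing_pdfE (a b : R) : 0 < b -> b <= a ->
  spacing_pdf a b =
  (fun s => s / (4 * a * b) * arc_angle a b (s / 2)) \_ `]0, +oo[.
Proof.
move=> b0 ba; have a0 := lt_le_trans b0 ba.
apply/funext => s; rewrite patchE mem_setE in_itv/= andbT /spacing_pdf.
case: ltgtP => [//|s0|->]; last first.
  (* At [s = 0] the first formula gives 0, the value of the restriction outside the open
     half-line. *)
  by rewrite mulr_ge0 ?ltW// mulr0 mul0r.
have half (x : R) : (s / 2 <= x) = (s <= 2 * x) by rewrite ler_pdivrMr// mulrC.
have inv_half (x : R) : 2 * x / s = x / (s / 2) by field; rewrite gt_eqF.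
rewrite /arc_angle !half !inv_half.
case: ifP => _; first by field; rewrite !gt_eqF.
case: ifP => // _; case: ifP => // _.
by rewrite mulr0.
Qed.

Lemma measurable_spacing_pdf (a b : R) : 0 < b -> b <= a ->
  measurable_fun [set: R] (spacing_pdf a b).
Proof.
move=> b0 ba; rewrite spacing_pdfE//.
apply: (measurable_restrictT _ _).1 => //.
apply: measurable_funM; first exact: measurable_funM.
have half_pos : [set s / 2 | s in (`]0%R, +oo[%classic : set R)] `<=` `]0%R, +oo[.
  by move=> _ [s /= + <-]; rewrite !in_itv/= !andbT => s0; rewrite divr_gt0.
apply: (measurable_comp _ half_pos (measurable_arc_angle _ _ b0 ba)) => //.
exact: measurable_funM.
Qed.

Lemma spacing_pdf_ge0 (a b s : R) : 0 < b -> b <= a -> 0 <= spacing_pdf a b s.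
Proof.
move=> b0 ba; have a0 := lt_le_trans b0 ba.
rewrite spacing_pdfE// patchE; case: ifPn => //.
rewrite mem_setE in_itv/= andbT => s0.
rewrite mulr_ge0//; last by rewrite arc_angle_ge0// divr_gt0.
by rewrite divr_ge0 ?mulr_ge0 ?ltW.
Qed.

(** Independence is agreement of the joint law with the product measure on measurable rectangles,
    and these determine the product measure. *)
Lemma independent_RV_joint {d} {T : measurableType d} {P : probability T R}
    {X Y : {RV P >-> R}} {m1 m2 : probability (measurableTypeR R) R} :
  (forall A : set R, measurable A -> distribution P X A = m1 A) ->
  (forall A : set R, measurable A -> distribution P Y A = m2 A) ->
  independent_RV X Y ->
  forall E : set (R * R), measurable E ->
    P ((fun w => (X w, Y w)) @^-1` E) = (m1 \x m2)%E E.
Proof.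
move=> Xm1 Ym2 XY E mE.
have mXY : measurable_fun [set: T]
    (fun w => (X w, Y w) : measurableTypeR R * measurableTypeR R).
  apply: measurable_fun_pair; first exact (measurable_funPT X).
  exact (measurable_funPT Y).
pose m := measure_function_pushforward__canonical__measure_function_Measure P mXY.
rewrite (@product_measure_unique _ _ _ _ _ m1 m2 m)// => A B mA mB.
apply: eq_trans (XY _ _ mA mB) _.
by congr (_ * _)%E; [exact: Xm1|exact: Ym2].
Qed.

(** The joint density is [1 / (2 * a * (2 * b))], and by symmetry in both axes the four quadrants
    contribute equally; this leaves the constant [1 / (a * b)] for one quadrant. *)
Lemma uniform_rect_radius (a b : R) (a0 : 0 < a) (b0 : 0 < b) (A : set R) :
  measurable A ->
  (uniform_prob (gtrN a0) \x uniform_prob (gtrN b0))%E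
    [set z | A (2 * Num.sqrt (z.1 ^+ 2 + z.2 ^+ 2))] =
  ((a * b)^-1%:E * \int[mu]_(x in `]0%R, +oo[) \int[mu]_(y in `]0%R, +oo[)
     (\1_(rect_radius a b A) (x, y))%:E)%E.
Proof.
move=> mA; set E0 := [set z | _].
have mE0 : measurable E0.
  by rewrite -[X in measurable X]setTI; exact: measurable_spacing.
pose f (z : R * R) : \bar R := (\1_E0 z)%:E.
have mf : measurable_fun [set: R * R] f.
  by apply/measurable_EFinP; exact: measurable_indic.
have f0 z : (0 <= f z)%E by rewrite lee_fin.
pose g (z : R * R) : \bar R := (\1_(rect_radius a b A) z)%:E.
have mg : measurable_fun [set: R * R] g.
  apply/measurable_EFinP; apply: measurable_indic; exact: measurable_rect_radius.
have g0 z : (0 <= g z)%E by rewrite lee_fin.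
have gE x y : g (x, y) = if (`|x| <= a) && (`|y| <= b) then f (x, y) else 0%E.
  rewrite /g /f !indicE.
  have -> : (x, y) \in rect_radius a b A =
      [&& `|x| <= a, `|y| <= b & (x, y) \in E0].
    by apply/idP/and3P; rewrite !inE.
  by rewrite andbA; case: ifP.
have E0N1 x y : ((- x, y) \in E0) = ((x, y) \in E0).
  by apply/idP/idP; rewrite !inE /E0/= sqrrN.
have E0N2 x y : ((x, - y) \in E0) = ((x, y) \in E0).
  by apply/idP/idP; rewrite !inE /E0/= sqrrN.
have g_even1 x y : g (- x, y) = g (x, y).
  by rewrite !gE /f !indicE E0N1 normrN.
have g_even2 x y : g (x, - y) = g (x, y).
  by rewrite !gE /f !indicE E0N2 normrN.
have fg : (\int[mu]_(x in `[(- a)%R, a]) \int[mu]_(y in `[(- b)%R, b]) f (x, y) =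
    \int[mu]_x \int[mu]_y g (x, y))%E.
  rewrite integral_mkcond; apply: eq_integral => x _.
  rewrite patchE mem_setE in_itv/= -ler_norml; case: ifPn => xa.
    rewrite integral_mkcond; apply: eq_integral => y _.
    by rewrite gE xa/= patchE mem_setE in_itv/= -ler_norml.
  by apply/esym/integral0_eq => y _; rewrite gE (negbTE xa).
have gD : (\int[mu]_x \int[mu]_y g (x, y) = 2%:E * (2%:E *
    \int[mu]_(x in `]0%R, +oo[) \int[mu]_(y in `]0%R, +oo[) g (x, y)))%E.
  (* Evenness is used in [x] for the outer integral, then in [y] for the inner one. *)
  rewrite ge0_integral_even; last 3 first.
  - exact: (@measurable_fun_fubini_tonelli_F _ _ (measurableTypeR R) (measurableTypeR R) R mu g).
  - by move=> x; exact: integral_ge0.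
  - by move=> x; apply: eq_integral => y _; rewrite g_even1.
  congr (_ * _)%E; rewrite -ge0_integralZl//; last 2 first.
  - exact: (@measurable_fun_integral_restrict _ _ (measurableTypeR R) (measurableTypeR R) R mu).
  - by move=> x _; exact: integral_ge0.
  apply: eq_integral => x _; rewrite ge0_integral_even//.
  exact: measurable_fun_pair2.
transitivity (\int[uniform_prob (gtrN a0) \x uniform_prob (gtrN b0)]_z f z)%E.
  by rewrite /f integral_indic// setIT.
rewrite fubini_tonelli1// integral_uniform//; last 2 first.
- exact: measurable_fun_fubini_tonelli_F.
- by move=> x; exact: integral_ge0.
under eq_integral.
  move=> x _; rewrite /fubini_F integral_uniform//; last first.
    exact: measurable_fun_pair2.
  over.
rewrite ge0_integralZl//; last 3 first.
- exact: (@measurable_fun_integral_restrict _ _ (measurableTypeR R) (measurableTypeR R) R mu).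
- by move=> x _; exact: integral_ge0.
- by rewrite lee_fin invr_ge0 opprK addr_ge0// ltW.
rewrite fg gD !muleA -!EFinM; congr (_%:E * _)%E.
have dbl (x : R) : x - - x = 2 * x by ring.
by rewrite !dbl; field; rewrite !gt_eqF.
Qed.

Lemma has_density_spacing d (T : measurableType d) (P : probability T R)
    (a0 b0 : R) (a0_gt0 : 0 < a0) (b0_gt0 : 0 < b0) (a b : {RV P >-> R}) :
  (forall A : set R, measurable A ->
     distribution P a A = uniform_prob (gtrN a0_gt0) A) ->
  (forall A : set R, measurable A ->
     distribution P b A = uniform_prob (gtrN b0_gt0) A) ->
  independent_RV a b -> b0 <= a0 ->
  has_density P (fun w => 2 * Num.sqrt (a w ^+ 2 + b w ^+ 2))
    (spacing_pdf a0 b0).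
Proof.
move=> aU bU ab ba.
have mr : measurable_fun [set: R * R]
    (fun z => 2 * Num.sqrt (z.1 ^+ 2 + z.2 ^+ 2) : R).
  exact: measurable_spacing.
split.
- apply: (measurableT_comp (g := fun w => (a w, b w)) mr).
  by apply: measurable_fun_pair; exact: measurable_funPT.
- exact: measurable_spacing_pdf.
- by move=> s; exact: spacing_pdf_ge0.
move=> A mA.
have mE : measurable [set z : R * R | A (2 * Num.sqrt (z.1 ^+ 2 + z.2 ^+ 2))].
  by rewrite -[X in measurable X]setTI; exact: mr.
rewrite /pushforward -(_ : (fun w => (a w, b w)) @^-1`
  [set z | A (2 * Num.sqrt (z.1 ^+ 2 + z.2 ^+ 2))] =
  (fun w => 2 * Num.sqrt (a w ^+ 2 + b w ^+ 2)) @^-1` A)//.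
rewrite (independent_RV_joint aU bU ab _ mE) uniform_rect_radius//.
rewrite integral_rect_radius//.
pose f s := (\1_A s * spacing_pdf a0 b0 s)%:E.
have f0 s : (0 <= f s)%E by rewrite lee_fin mulr_ge0// spacing_pdf_ge0.
have mf : measurable_fun [set: R] f.
  apply/measurable_EFinP; apply: measurable_funM; first exact: measurable_indic.
  exact: measurable_spacing_pdf.
(* The density vanishes off the open half-line, so only positive spacings contribute. *)
transitivity (\int[mu]_(s in `]0%R, +oo[) f s)%E; last first.
  rewrite integral_mkcond [RHS]integral_mkcond; apply: eq_integral => s _.
  rewrite !patchE /f indicE; case: (_ \in A); rewrite ?mul1r ?mul0r ?if_same//.
  case: ifPn => // s0; rewrite spacing_pdfE// patchE (negbTE s0)//.
rewrite (ge0_integral_scale f (ltr0n R 2))//.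
have [a_neq0 b_neq0] : a0 != 0 /\ b0 != 0 by rewrite !gt_eqF.
have m2 : measurable_fun [set: R] (fun r : R => 2 * r) by exact: mulrl_measurable.
have ab_ge0 : (0 <= (2 * (a0 * b0))%:E)%E by rewrite lee_fin !mulr_ge0// ltW.
(* The Jacobian 2 of [s = 2 * r] is written so that the normalizing constant cancels; the rest turns
   [2 * r / (4 * a0 * b0)] into the radial weight [r]. *)
rewrite (_ : 2%:E = (((a0 * b0)^-1)%:E * (2 * (a0 * b0))%:E)%E); last first.
  by rewrite -EFinM; rewrite mulrCA mulVf ?mulr1// mulf_neq0.
rewrite -muleA; congr (_ * _)%E; rewrite -ge0_integralZl//=; last first.
  by apply: measurable_funTS; exact: (measurableT_comp mf m2).
apply: eq_integral => r.
rewrite mem_setE in_itv/= andbT => r0.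
rewrite /f spacing_pdfE// patchE mem_setE in_itv/= andbT mulr_gt0// -EFinM.
congr _%:E; rewrite (_ : 2 * r / 2 = r); last by field.
by field; rewrite a_neq0 b_neq0.
Qed.

End law.

(** * Eigenvalues of the matrix, and the final statement *)

Lemma is_level_spacing_symm_traceless (R : realType) (a b : R) :
  is_level_spacing (symm_traceless_mx a b) (2 * Num.sqrt (a ^+ 2 + b ^+ 2)).
Proof.
set q := Num.sqrt _; have q0 : 0 <= q by exact: sqrtr_ge0.
exists (- q), q; split; [by rewrite (le_trans _ q0)// oppr_le0| |ring].
have qq : q%:P * q%:P = a%:P * a%:P + b%:P * b%:P.
  by rewrite -!polyCM -polyCD -!expr2 sqr_sqrtr// addr_ge0 ?sqr_ge0.
rewrite /char_poly (expand_det_row _ ord0) !big_ord_recl big_ord0.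
rewrite /cofactor !det_mx11 !mxE/= !polyCN !mulr1n !mulr0n expr0 expr1.
(* The trace is 0 and the determinant [- (a ^ 2 + b ^ 2)], so the roots are [q] and [- q]. *)
transitivity ('X * 'X - (a%:P * a%:P + b%:P * b%:P) : {poly R}); first by ring.
by rewrite -qq; ring.
Qed.

Theorem mainTheorem6 (d : measure_display) (T : measurableType d)
    (R : realType) (P : probability T R) (a0 b0 : R)
    (a0_gt0 : 0 < a0) (b0_gt0 : 0 < b0) (a b : {RV P >-> R})
    (a_unif : forall A : set R, measurable A ->
       distribution P a A = uniform_prob (gtrN a0_gt0) A)
    (b_unif : forall A : set R, measurable A ->
       distribution P b A = uniform_prob (gtrN b0_gt0) A)
    (ab_indep : independent_RV a b) :
  let S := fun w : T => 2 * Num.sqrt (a w ^+ 2 + b w ^+ 2) in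
  [/\ (forall w : T, is_level_spacing (symm_traceless_mx (a w) (b w)) (S w)),
      (b0 <= a0 -> has_density P S (spacing_pdf a0 b0)) &
      (a0 <= b0 -> has_density P S (spacing_pdf b0 a0))].
Proof.
split.
- by move=> w; exact: is_level_spacing_symm_traceless.
- exact: has_density_spacing a_unif b_unif ab_indep.
(* The spacing and independence are symmetric in [a] and [b], so the first case applies with the
   roles exchanged. *)
- move=> ab; rewrite (_ : (fun w => _) =
      fun w => 2 * Num.sqrt (b w ^+ 2 + a w ^+ 2)); last first.
    by apply/funext => w; rewrite addrC.
  apply: has_density_spacing b_unif a_unif _ ab => A B mA mB.
  by rewrite setIC muleC; exact: ab_indep.
Qed.
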